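(* Let $0<T<\infty$ and let $\xi,\xi_n\in S_0([0,T])$. Let $\varphi:[-a,0]\to[0,b]$ and $\varphi_n:[-a_n,0]\to[0,b_n]$ be the conformal weldings for $\xi$ and $\xi_n$, respectively. If $\xi_n\to\xi$ uniformly on $[0,T]$, then $a_n\to a$, $b_n\to b$, and $\varphi_n\to\varphi$ uniformly on $[-c,0]$ for any $[-c,0]\subset(-a,0]$.
   Context: A driver is a continuous function $\xi:[0,T]\to\mathbb{R}$. The upwards Loewner flow of $\xi$ in the upper half plane $\mathbb{H}$ is the solution of $\partial_t h_t(z)=\frac{-2}{h_t(z)-\xi(t)}$, $h_0(z)=z$; for $z\in\mathbb{H}$ it exists on all of $[0,T]$. Hitting times: for $x\in\mathbb{R}\setminus\{\xi(0)\}$, let $x(t)=h_t(x;\xi)$ be the real solution of the same ODE started at $x$, and let $\tau(x;\xi):=\inf\{t\ge 0: \liminf_{s\nearrow t}|x(s)-\xi(s)|=0\}$ (with $t\in[0,T]$ and $\inf\emptyset=+\infty$); also $\tau(\xi(0);\xi)=0$. Simple-curve drivers: $S([0,T])$ is the set of continuous $\xi:[0,T]\to\mathbb{R}$ that generate a simple curve, i.e. there is an injective continuous $\gamma:[0,T]\to\mathbb{H}\cup\{\xi(T)\}$ with $\gamma(0)=\xi(T)$ and $\gamma((0,T])\subset\mathbb{H}$ such that $h_T$ maps $\mathbb{H}$ conformally onto $\mathbb{H}\setminus\gamma((0,T])$. $S_0([0,T])$ is the set of $\xi\in S([0,T])$ with $\xi(0)=0$. Conformal welding: for $\xi\in S_0([0,T])$,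 $T<\infty$, the hitting time function is finite exactly on a compact interval $[-a,b]$ with $-a<0<b$, is continuous there, strictly decreasing on $[-a,0]$ and strictly increasing on $[0,b]$, with $\tau(-a)=\tau(b)=T$. With $\tau_-=\tau|_{[-a,0]}$, $\tau_+=\tau|_{[0,b]}$, the conformal welding of $\xi$ is the homeomorphism $\varphi=\tau_+^{-1}\circ\tau_-:[-a,0]\to[0,b]$, i.e. $\tau(x)=\tau(\varphi(x))$. *)

(* Defs.v *)
From Stdlib Require Import Reals.
From Coquelicot Require Import Coquelicot.

Open Scope R_scope.

Definition Icc (a b : R) : R -> Prop := fun x => a <= x <= b.
Definition Ico (a b : R) : R -> Prop := fun x => a <= x < b.
Definition Ioc (a b : R) : R -> Prop := fun x => a < x <= b.

Definition uniform_cvg_on (D : R -> Prop) (f_ : nat -> R -> R) (f : R -> R) : Prop :=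
  forall eps : R, 0 < eps ->
    exists N : nat, forall n : nat, (N <= n)%nat ->
      forall x : R, D x -> Rabs (f_ n x - f x) < eps.

(* Derivative relative to [D], hence one-sided at an end point of an interval
   [D]; for [D] the whole line this is Coquelicot's [is_derive]. *)
Definition is_derive_within {V : NormedModule R_AbsRing}
    (D : R -> Prop) (f : R -> V) (x : R) (l : V) : Prop :=
  filterdiff (U := AbsRing_NormedModule R_AbsRing) (V := V)
    f (within D (locally x)) (fun u : R => scal u l).

(* Only the values of [f] on [[0, t)] matter.  At [t = 0] the supremum is over
   the empty set, so the value is [m_infty]. *)
Definition liminf_left (f : R -> R) (t : R) : Rbar :=
  Rbar_lub (fun m : Rbar =>
    exists u : R, 0 <= u < t /\
      m = Glb_Rbar (fun v : R => exists s : R, u < s < t /\ v = f s)).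

Definition upper_half_plane (z : C) : Prop := 0 < Im z.

(* Drivers and curves are total functions; only their values on [[0, T]] are
   ever used. *)

Definition upward_flow (T : R) (xi : R -> R) (h : R -> C -> C) : Prop :=
  forall z : C, upper_half_plane z ->
    h 0 z = z /\
    forall t : R, Icc 0 T t ->
      h t z <> RtoC (xi t) /\
      is_derive_within (V := C_R_NormedModule) (Icc 0 T) (fun s : R => h s z) t
        (Cdiv (RtoC (-2)) (Cminus (h t z) (RtoC (xi t)))).

Definition real_upward_solution (xi : R -> R) (t x : R) (y : R -> R) : Prop :=
  y 0 = x /\
  forall s : R, Ico 0 t s ->
    y s <> xi s /\
    is_derive_within (V := R_NormedModule) (Ico 0 t) y s (-2 / (y s - xi s)).

(* Solutions of the equation are unique, so letting the solution on [[0, t)]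
   depend on [t] is the same as using the maximal solution started at [x].
   [Glb_Rbar] of the empty set is [p_infty]. *)
Definition hitting_time (T : R) (xi : R -> R) (x : R) : Rbar :=
  if Req_dec_T x (xi 0) then Finite 0
  else Glb_Rbar (fun t : R =>
    Icc 0 T t /\
    exists y : R -> R, real_upward_solution xi t x y /\
      liminf_left (fun s : R => Rabs (y s - xi s)) t = Finite 0).

Definition conformal_onto (A B : C -> Prop) (f : C -> C) : Prop :=
  (forall z : C, A z -> ex_derive (K := C_AbsRing) (V := C_NormedModule) f z) /\
  (forall z w : C, A z -> A w -> f z = f w -> z = w) /\
  (forall w : C, B w <-> exists z : C, A z /\ f z = w).

Definition driver (T : R) (xi : R -> R) : Prop :=
  continuous_on (U := R_UniformSpace) (Icc 0 T) xi.

Definition simple_curve_driver (T : R) (xi : R -> R) : Prop :=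
  driver T xi /\
  exists (h : R -> C -> C) (gamma : R -> C),
    upward_flow T xi h /\
    continuous_on (U := C_UniformSpace) (Icc 0 T) gamma /\
    (forall s t : R, Icc 0 T s -> Icc 0 T t -> gamma s = gamma t -> s = t) /\
    gamma 0 = RtoC (xi T) /\
    (forall t : R, Ioc 0 T t -> upper_half_plane (gamma t)) /\
    conformal_onto upper_half_plane
      (fun w : C => upper_half_plane w /\
        ~ exists t : R, Ioc 0 T t /\ gamma t = w)
      (h T).

Definition simple_curve_driver0 (T : R) (xi : R -> R) : Prop :=
  simple_curve_driver T xi /\ xi 0 = 0.

Definition homeomorphism_onto (A B : R -> Prop) (f : R -> R) : Prop :=
  continuous_on (U := R_UniformSpace) A f /\
  (forall x : R, A x -> B (f x)) /\
  exists g : R -> R,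
    continuous_on (U := R_UniformSpace) B g /\
    (forall y : R, B y -> A (g y)) /\
    (forall x : R, A x -> g (f x) = x) /\
    (forall y : R, B y -> f (g y) = y).

(* [phi] is the conformal welding of [xi], with domain [[-a, 0]] and range
   [[0, b]]. *)
Definition conformal_welding (T : R) (xi : R -> R) (a b : R) (phi : R -> R) : Prop :=
  0 < a /\ 0 < b /\
  (forall x : R, is_finite (hitting_time T xi x) <-> Icc (- a) b x) /\
  homeomorphism_onto (Icc (- a) 0) (Icc 0 b) phi /\
  (forall x : R, Icc (- a) 0 x ->
    hitting_time T xi x = hitting_time T xi (phi x)).

(* Main.v *)
Require Import Defs.
From Stdlib Require Import Reals Lra Lia Classical Ranalysis5.
From Coquelicot Require Import Coquelicot.
Open Scope R_scope.

(** The theorem is a matter of the real flow [y' = -2 / (y - xi)] alone. Let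
    [tau] and [tau'] be the hitting times of two drivers [xi] and [eta] that
    start at 0 and differ by at most [e], and let [d > e].

    To the right of the drivers a point is pulled to the left, faster when it is
    closer to its driver. If [z] runs under [eta] from [x] and [y] runs under
    [xi] from [x - d], then as long as [z - y > e] the point [z] is farther from
    its driver than [y], so the gap [z - y] does not shrink and stays at least
    [d] ([right_solution_compare]). Hence [y] is caught no later than [z]:
    [tau (x - d) <= tau' x] ([hitting_time_compare_right]), and by reflection
    [tau (x + d) <= tau' x] on the left ([hitting_time_compare_left]). With
    [eta = xi] and [e = 0] the same gap estimate shows that [tau] is strictly
    increasing on the right ([hitting_time_increasing_right]).

    Since the domain of a welding is the set where the hitting time is finite,
    its end points for [xi] and [eta] differ by at most [d]
    ([welding_domain_compare]). Combining the comparisons on the two sides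
    through [tau x = tau (phi x)] gives
    [phi (x + d) - d <= psi x <= phi (x - d) + d] for the weldings [phi] of [xi]
    and [psi] of [eta] ([welding_compare]), with [phi 0] in place of
    [phi (x + d)] when [x + d] is positive. Uniform continuity of [phi] finishes
    the proof.

    The comparison needs that a starting point which is not caught by time [t]
    has a solution on the whole of [[0, t]] ([hit_or_survive]). Capping the
    distance to the driver from below by a positive constant makes the field
    Lipschitz, so that Picard iteration solves the capped equation globally; the
    capped solution is a true one while it keeps that distance. *)

(** * Monotonicity along an interval *)

Lemma nondecreasing_of_derive (f df : R -> R) (a b : R) :
  a <= b ->
  (forall s, a <= s <= b -> continuity_pt f s) ->
  (forall s, a < s < b -> is_derive f s (df s) /\ 0 <= df s) ->
  f a <= f b.
Proof.
  intros Hab Hc Hd.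
  (* The intermediate point may be an end point, where [df] is arbitrary. *)
  destruct (MVT_gen f a b (fun s => Rmax 0 (df s))) as [c [Hc1 Hc2]].
  - rewrite Rmin_left, Rmax_right by lra. intros s Hs.
    destruct (Hd s Hs) as [H1 H2]. rewrite Rmax_right by lra. exact H1.
  - rewrite Rmin_left, Rmax_right by lra. exact Hc.
  - assert (0 <= Rmax 0 (df c)) by apply Rmax_l. nra.
Qed.

(** Continuous induction; it replaces arguments with a first exit time. *)
Lemma real_induction (P : R -> Prop) (a b : R) :
  a <= b -> P a ->
  (forall r, a <= r < b -> (forall q, a <= q <= r -> P q) ->
     exists rho, 0 < rho /\ forall q, r < q <= r + rho -> q <= b -> P q) ->
  (forall r, a < r <= b -> (forall q, a <= q < r -> P q) -> P r) ->
  forall r, a <= r <= b -> P r.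
Proof.
  intros Hab H0 Hstep Hlim.
  set (A := fun r => a <= r <= b /\ forall q, a <= q <= r -> P q).
  assert (HA : A a).
  { split; [lra|]. intros q Hq. replace q with a by lra. exact H0. }
  destruct (completeness A) as [m [Hub Hlub]].
  - exists b. intros r [Hr _]. lra.
  - exists a. exact HA.
  - assert (Ham : a <= m) by (apply Hub; exact HA).
    assert (Hmb : m <= b) by (apply Hlub; intros r [Hr _]; lra).
    assert (Hlt : forall q, a <= q < m -> P q).
    { intros q Hq. destruct (classic (exists r, A r /\ q < r)) as [[r [[_ Hr] Hqr]]|Hn].
      - apply Hr. lra.
      - assert (m <= q); [|lra]. apply Hlub. intros r Hr.
        destruct (Rle_dec r q); [assumption|]. exfalso. apply Hn. exists r. split; [exact Hr|lra]. }
    assert (Hm : P m).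
    { destruct (Req_dec a m) as [<-|]; [exact H0|]. apply Hlim; [lra|exact Hlt]. }
    assert (HAm : forall q, a <= q <= m -> P q).
    { intros q Hq. destruct (Req_dec q m) as [->|]; [exact Hm|]. apply Hlt. lra. }
    destruct (Req_dec m b) as [->|Hne]; [exact HAm|].
    exfalso. destruct (Hstep m) as [rho [Hr1 Hr2]]; [lra|exact HAm|].
    assert (HAn : A (Rmin b (m + rho))).
    { split. { split; [apply Rmin_glb; lra|apply Rmin_l]. }
      intros q [Hq1 Hq2]. destruct (Rle_dec q m); [apply HAm; lra|].
      apply Hr2; [|eapply Rle_trans; [exact Hq2|apply Rmin_l]].
      split; [lra|]. eapply Rle_trans; [exact Hq2|apply Rmin_r]. }
    apply Hub in HAn. revert HAn. unfold Rmin. destruct (Rle_dec b (m + rho)); lra.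
Qed.

Lemma continuity_pt_gt (f : R -> R) (s c : R) :
  continuity_pt f s -> c < f s ->
  exists rho, 0 < rho /\ forall q, Rabs (q - s) < rho -> c < f q.
Proof.
  intros Hf Hc. destruct (Hf (f s - c)) as [rho [Hr Hq]]; [lra|].
  exists rho. split; [exact Hr|]. intros q Hqs.
  destruct (Req_dec q s) as [->|Hne]; [lra|].
  assert (H : Rabs (f q - f s) < f s - c).
  { apply (Hq q). split; [split; [exact I|auto]|exact Hqs]. }
  apply Rabs_def2 in H. lra.
Qed.

Lemma continuity_pt_left_ge (f : R -> R) (a s c : R) :
  a < s -> continuity_pt f s -> (forall q, a <= q < s -> c <= f q) -> c <= f s.
Proof.
  intros Has Hf Hq. destruct (Rle_dec c (f s)); [assumption|exfalso].
  destruct (continuity_pt_gt (fun r => - f r) s (- c)) as [rho [Hr Hn]].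
  { apply continuity_pt_opp; exact Hf. } { lra. }
  set (q := Rmax a (s - rho / 2)).
  assert (a <= q) by apply Rmax_l. assert (s - rho / 2 <= q) by apply Rmax_r.
  assert (q < s) by (apply Rmax_lub_lt; lra).
  specialize (Hq q ltac:(lra)). specialize (Hn q).
  assert (- c < - f q); [|lra]. apply Hn. apply Rabs_def1; lra.
Qed.

(** As long as [w] stays above the level [e] it cannot decrease, and as long as
    it does not decrease it stays above [e], so a start strictly above [e]
    closes the loop. The strict margin replaces the Lipschitz bound that a
    comparison of differential inequalities would need at the level itself. *)
Lemma barrier (w dw : R -> R) (e s : R) :
  0 <= s ->
  (forall r, 0 <= r <= s -> continuity_pt w r) ->
  (forall r, 0 < r < s -> is_derive w r (dw r)) ->
  (forall r, 0 < r < s -> e < w r -> 0 <= dw r) ->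
  e < w 0 -> w 0 <= w s.
Proof.
  intros Hs Hc Hd Hp He.
  apply (real_induction (fun r => w 0 <= w r) 0 s); try lra.
  - intros r Hr IH. assert (Hwr : w 0 <= w r) by (apply IH; lra).
    destruct (continuity_pt_gt w r e) as [rho [Hrho Hq]]; [apply Hc; lra|lra|].
    exists (rho / 2). split; [lra|]. intros q Hq1 Hq2.
    apply Rle_trans with (w r); [exact Hwr|].
    apply nondecreasing_of_derive with dw; [lra| |].
    + intros; apply Hc; lra.
    + intros u Hu. split; [apply Hd; lra|]. apply Hp; [lra|]. apply Hq. apply Rabs_def1; lra.
  - intros r Hr IH. apply continuity_pt_left_ge with 0; [lra|apply Hc; lra|exact IH].
Qed.

(** The bound on [dw] makes [- w^2 * exp (- 2 L s)] nondecreasing; it is never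
    positive and starts at 0, so it stays 0. *)
Lemma gronwall_zero (w dw : R -> R) (L s : R) :
  0 <= s ->
  (forall r, 0 <= r <= s -> continuity_pt w r) ->
  (forall r, 0 < r < s -> is_derive w r (dw r)) ->
  (forall r, 0 < r < s -> Rabs (dw r) <= L * Rabs (w r)) ->
  w 0 = 0 -> w s = 0.
Proof.
  intros Hs Hc Hd Hb H0.
  set (f := fun r => - (w r * w r) * exp (- (2 * L * r))).
  assert (Hf : f 0 <= f s).
  { apply nondecreasing_of_derive with
      (fun r => exp (- (2 * L * r)) * (2 * (L * (w r * w r) - w r * dw r))); [exact Hs| |].
    - intros r Hr. unfold f. apply continuity_pt_mult.
      + apply continuity_pt_opp, continuity_pt_mult; apply Hc; exact Hr.
      + apply derivable_continuous_pt. apply ex_derive_Reals_0. auto_derive. exact I.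
    - intros r Hr. split.
      + unfold f. assert (Hw := Hd r Hr). auto_derive.
        * repeat split; try (exists (dw r); exact Hw).
        * replace (Derive (fun x => w x) r) with (dw r) by (symmetry; apply is_derive_unique; exact Hw).
          ring.
      + apply Rmult_le_pos; [left; apply exp_pos|].
        assert (H1 := Hb r Hr).
        assert (H2 : w r * dw r <= Rabs (w r) * Rabs (dw r)).
        { rewrite <- Rabs_mult. apply Rle_abs. }
        assert (H3 : Rabs (w r) * Rabs (w r) = w r * w r).
        { rewrite <- Rabs_mult. apply Rabs_pos_eq. nra. }
        assert (H4 : 0 <= Rabs (w r)) by apply Rabs_pos.
        apply (Rmult_le_compat_l _ _ _ H4) in H1.
        replace (Rabs (w r) * (L * Rabs (w r))) with (L * (w r * w r)) in H1 by (rewrite <- H3; ring).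
        lra. }
  unfold f in Hf. rewrite H0 in Hf. assert (Hx := exp_pos (- (2 * L * s))).
  destruct (Req_dec (w s) 0) as [|Hn]; [assumption|exfalso].
  assert (Hp : 0 < w s * w s * exp (- (2 * L * s))).
  { apply Rmult_lt_0_compat; [apply Rsqr_pos_lt; exact Hn|exact Hx]. }
  lra.
Qed.

(** * Global solutions for Lipschitz fields *)

(** The sequences [u n - 2 C / 2^n] and [u n + 2 C / 2^n] are adjacent, which
    gives the convergence and the rate at the same time. *)
Lemma geometric_cauchy (u : nat -> R) (C : R) :
  (forall n, Rabs (u (S n) - u n) <= C * (1 / 2) ^ n) ->
  forall n, Rabs (Lim_seq u - u n) <= 2 * C * (1 / 2) ^ n.
Proof.
  intros Hu.
  set (lo := fun n => u n - 2 * C * (1 / 2) ^ n).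
  set (hi := fun n => u n + 2 * C * (1 / 2) ^ n).
  assert (Hlo : forall n, lo n <= lo (S n)).
  { intros n. unfold lo. specialize (Hu n). apply Rabs_le_between in Hu. simpl pow. lra. }
  assert (Hhi : forall n, hi (S n) <= hi n).
  { intros n. unfold hi. specialize (Hu n). apply Rabs_le_between in Hu. simpl pow. lra. }
  assert (Hz : forall c, is_lim_seq (fun n => c * (1 / 2) ^ n) 0).
  { intros c. replace (Finite 0) with (Rbar_mult c 0) by (simpl; f_equal; ring).
    apply is_lim_seq_scal_l, is_lim_seq_geom. rewrite Rabs_pos_eq; lra. }
  destruct (ex_lim_seq_adj lo hi Hlo Hhi) as [[l Hl] [[h Hh] Hlh]].
  { apply is_lim_seq_ext with (fun n => 4 * C * (1 / 2) ^ n); [|apply Hz].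
    intros n. unfold lo, hi. ring. }
  rewrite (is_lim_seq_unique _ _ Hl), (is_lim_seq_unique _ _ Hh) in Hlh.
  injection Hlh as <-.
  assert (Hul : is_lim_seq u l).
  { apply is_lim_seq_ext with (fun n => lo n + 2 * C * (1 / 2) ^ n).
    { intros n. unfold lo. ring. }
    replace l with (l + 0) by ring. apply is_lim_seq_plus'; [exact Hl|apply Hz]. }
  rewrite (is_lim_seq_unique _ _ Hul). intros n. simpl.
  assert (H1 := is_lim_seq_incr_compare lo l Hl Hlo n).
  assert (H2 := is_lim_seq_decr_compare hi l Hh Hhi n).
  unfold lo, hi in *. apply Rabs_le_between. lra.
Qed.

Fixpoint picard (g xi : R -> R) (x : R) (n : nat) (t : R) : R :=
  match n with
  | O => x
  | S n => x + RInt (fun s => g (picard g xi x n s - xi s)) 0 t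
  end.

Lemma lipschitz_continuous (g : R -> R) (L : R) :
  (forall r q, Rabs (g r - g q) <= L * Rabs (r - q)) -> forall r, continuity_pt g r.
Proof.
  intros Hg r eps He. exists (eps / (Rabs L + 1)).
  assert (HL := Rabs_pos L).
  split; [apply Rdiv_lt_0_compat; lra|]. intros q [_ Hq]. simpl in *.
  unfold R_dist in *. eapply Rle_lt_trans; [apply Hg|].
  apply Rle_lt_trans with ((Rabs L + 1) * Rabs (q - r)).
  - apply Rmult_le_compat_r; [apply Rabs_pos|]. assert (H := Rle_abs L). lra.
  - apply Rlt_le_trans with ((Rabs L + 1) * (eps / (Rabs L + 1))).
    + apply Rmult_lt_compat_l; lra.
    + right. field. lra.
Qed.

Lemma is_derive_primitive (x : R) (f : R -> R) (t : R) :
  (forall s, continuity_pt f s) ->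
  is_derive (fun u => x + RInt f 0 u) t (f t).
Proof.
  intros Hf.
  replace (f t) with (plus zero (f t)) by apply plus_zero_l.
  apply @is_derive_plus; [apply @is_derive_const|].
  apply is_derive_RInt with 0; [|apply continuity_pt_filterlim, Hf].
  apply filter_forall. intros u. apply @RInt_correct. apply @ex_RInt_continuous.
  intros z _. apply continuity_pt_filterlim, Hf.
Qed.

Lemma continuous_ex_RInt (f : R -> R) (a b : R) :
  (forall s, continuity_pt f s) -> ex_RInt f a b.
Proof.
  intros Hf. apply @ex_RInt_continuous. intros z _. apply continuity_pt_filterlim, Hf.
Qed.

Lemma derive_continuity_pt (f : R -> R) (s l : R) : is_derive f s l -> continuity_pt f s.
Proof.
  intros H. apply continuity_pt_filterlim. apply @ex_derive_continuous. exists l. exact H.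
Qed.

Lemma abs_le_of_derive (u du v dv : R -> R) (t : R) :
  0 <= t ->
  (forall s, continuity_pt u s) -> (forall s, continuity_pt v s) ->
  (forall s, 0 < s < t -> is_derive u s (du s)) ->
  (forall s, 0 < s < t -> is_derive v s (dv s)) ->
  (forall s, 0 < s < t -> Rabs (du s) <= dv s) ->
  Rabs (u t - u 0) <= v t - v 0.
Proof.
  intros Ht Hcu Hcv Hu Hv Hle. apply Rabs_le_between. split.
  - assert (H : v 0 + u 0 <= v t + u t); [|lra].
    apply (nondecreasing_of_derive (fun s => v s + u s) (fun s => dv s + du s)); [exact Ht| |].
    + intros s _. apply continuity_pt_plus; auto.
    + intros s Hs. split; [apply @is_derive_plus; auto|].
      assert (H := Hle s Hs). apply Rabs_le_between in H. lra.
  - assert (H : v 0 - u 0 <= v t - u t); [|lra].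
    apply (nondecreasing_of_derive (fun s => v s - u s) (fun s => dv s - du s)); [exact Ht| |].
    + intros s _. apply continuity_pt_minus; auto.
    + intros s Hs. split; [apply @is_derive_minus; auto|].
      assert (H := Hle s Hs). apply Rabs_le_between in H. lra.
Qed.

Definition bounded_lipschitz (L M : R) (g : R -> R) : Prop :=
  0 < L /\ (forall r q, Rabs (g r - g q) <= L * Rabs (r - q)) /\ (forall r, Rabs (g r) <= M).

Lemma field_continuous (g xi : R -> R) (L M : R) (u : R -> R) :
  bounded_lipschitz L M g -> (forall s, continuity_pt xi s) ->
  (forall s, continuity_pt u s) -> forall s, continuity_pt (fun s => g (u s - xi s)) s.
Proof.
  intros [HL [Hg HM]] Hxi. intros Hu s. apply (continuity_pt_comp (fun s => u s - xi s) g).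
  - apply continuity_pt_minus; [apply Hu|apply Hxi].
  - apply lipschitz_continuous with L. exact Hg.
Qed.

Lemma picard_continuous (g xi : R -> R) (L M x : R) n s :
  bounded_lipschitz L M g -> (forall s, continuity_pt xi s) ->
  continuity_pt (picard g xi x n) s.
Proof.
  intros Hb Hxi.
  revert s. induction n as [|n IH]; intros s.
  - simpl. apply continuity_pt_const. intros p q. reflexivity.
  - simpl. eapply derive_continuity_pt.
    apply (is_derive_primitive x (fun s => g (picard g xi x n s - xi s))).
    apply (field_continuous g xi L M); [exact Hb|exact Hxi|apply IH].
Qed.

Lemma picard_derive (g xi : R -> R) (L M x : R) n s :
  bounded_lipschitz L M g -> (forall s, continuity_pt xi s) ->
  is_derive (picard g xi x (S n)) s (g (picard g xi x n s - xi s)).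
Proof.
  intros Hb Hxi. simpl. apply (is_derive_primitive x (fun s => g (picard g xi x n s - xi s))).
  apply (field_continuous g xi L M); try assumption.
  intros r. apply (picard_continuous g xi L M); assumption.
Qed.

Lemma picard_at_0 (g xi : R -> R) (x : R) n : picard g xi x n 0 = x.
Proof.
  destruct n as [|n]; [reflexivity|]. simpl. rewrite RInt_point. apply Rplus_0_r.
Qed.

Lemma picard_lipschitz (g xi : R -> R) (L M x : R) n s t :
  bounded_lipschitz L M g -> (forall s, continuity_pt xi s) ->
  Rabs (picard g xi x n t - picard g xi x n s) <= M * Rabs (t - s).
Proof.
  intros Hb Hxi. assert (Hb' := Hb). destruct Hb' as [HL [Hg HM]].
  assert (HM0 : 0 <= M) by (eapply Rle_trans; [apply Rabs_pos|apply (HM 0)]).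
  destruct n as [|n].
  - simpl. rewrite Rminus_diag, Rabs_R0. apply Rmult_le_pos; [exact HM0|apply Rabs_pos].
  - destruct (MVT_gen (picard g xi x (S n)) s t (fun r => g (picard g xi x n r - xi r))) as [c [_ Hc]].
    + intros r _. apply (picard_derive g xi L M); assumption.
    + intros r _. apply (picard_continuous g xi L M); assumption.
    + rewrite Hc, Rabs_mult. apply Rmult_le_compat_r; [apply Rabs_pos|apply HM].
Qed.

(** Against the weight [exp (2 L t)] each iteration gains a factor 1/2, whatever
    the length of the time interval, so no subdivision into short steps is
    needed. *)
Lemma picard_step (g xi : R -> R) (L M x : R) n t :
  bounded_lipschitz L M g -> (forall s, continuity_pt xi s) ->
  0 <= t ->
  Rabs (picard g xi x (S n) t - picard g xi x n t) <= M / (2 * L) * exp (2 * L * t) * (1 / 2) ^ n.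
Proof.
  intros Hb Hxi. assert (Hb' := Hb). destruct Hb' as [HL [Hg HM]].
  assert (HM0 : 0 <= M) by (eapply Rle_trans; [apply Rabs_pos|apply (HM 0)]).
  assert (HK : 0 <= M / (2 * L)) by (apply Rdiv_le_0_compat; lra).
  revert t. induction n as [|n IH]; intros t Ht.
  - assert (H := picard_lipschitz g xi L M x 1 0 t Hb Hxi). rewrite picard_at_0 in H.
    change (picard g xi x 0 t) with x. eapply Rle_trans; [exact H|].
    rewrite Rminus_0_r, (Rabs_pos_eq t) by exact Ht.
    assert (He := exp_ineq1_le (2 * L * t)).
    apply Rle_trans with (M / (2 * L) * (2 * L * t)).
    + right. field. lra.
    + simpl. rewrite Rmult_1_r. apply Rmult_le_compat_l; lra.
  - set (K := M / (2 * L)) in *.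
    assert (H : Rabs ((picard g xi x (S (S n)) t - picard g xi x (S n) t)
                      - (picard g xi x (S (S n)) 0 - picard g xi x (S n) 0))
                <= K * exp (2 * L * t) * (1 / 2) ^ S n - K * exp (2 * L * 0) * (1 / 2) ^ S n).
    { apply (abs_le_of_derive
        (fun t => picard g xi x (S (S n)) t - picard g xi x (S n) t)
        (fun s => g (picard g xi x (S n) s - xi s) - g (picard g xi x n s - xi s))
        (fun t => K * exp (2 * L * t) * (1 / 2) ^ S n)
        (fun s => L * (K * exp (2 * L * s) * (1 / 2) ^ n))); [exact Ht| | | | |].
      - intros s. apply continuity_pt_minus; (apply (picard_continuous g xi L M); assumption).
      - intros s. apply derivable_continuous_pt, ex_derive_Reals_0. auto_derive. exact I.
      - intros s _. apply @is_derive_minus; (apply (picard_derive g xi L M); assumption).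
      - intros s _. auto_derive; [exact I|]. simpl pow. field.
      - intros s Hs. eapply Rle_trans; [apply Hg|]. apply Rmult_le_compat_l; [lra|].
        match goal with |- Rabs ?e <= _ =>
          replace e with (picard g xi x (S n) s - picard g xi x n s) by ring end.
        apply IH. lra. }
    rewrite !picard_at_0 in H.
    assert (0 <= K * exp (2 * L * 0) * (1 / 2) ^ S n).
    { apply Rmult_le_pos; [apply Rmult_le_pos; [exact HK|left; apply exp_pos]|apply pow_le; lra]. }
    replace (picard g xi x (S (S n)) t - picard g xi x (S n) t - (x - x))
      with (picard g xi x (S (S n)) t - picard g xi x (S n) t) in H by ring.
    lra.
Qed.

(** Global existence on the half-line for a driven equation with a bounded
    Lipschitz field: the iterates converge geometrically at each time. *)
Lemma picard_exists (g xi : R -> R) (L M x : R) :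
  bounded_lipschitz L M g -> (forall s, continuity_pt xi s) ->
    exists y : R -> R, y 0 = x /\ forall s, 0 <= s -> is_derive y s (g (y s - xi s)).
Proof.
  intros Hb Hxi. assert (Hb' := Hb). destruct Hb' as [HL [Hg HM]].
  assert (HM0 : 0 <= M) by (eapply Rle_trans; [apply Rabs_pos|apply (HM 0)]).
  set (C := fun t => M / (2 * L) * exp (2 * L * t)).
  assert (HC0 : forall t, 0 <= C t).
  { intros t. apply Rmult_le_pos; [apply Rdiv_le_0_compat; lra|left; apply exp_pos]. }
  assert (HCinc : forall s t, s <= t -> C s <= C t).
  { intros s t Hst. apply Rmult_le_compat_l; [apply Rdiv_le_0_compat; lra|].
    destruct (Req_dec s t) as [->|]; [lra|]. left. apply exp_increasing. nra. }
  set (l := fun t => real (Lim_seq (fun n => picard g xi x n (Rmax 0 t)))).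
  assert (Hl : forall n t, Rabs (l t - picard g xi x n (Rmax 0 t)) <= 2 * C (Rmax 0 t) * (1 / 2) ^ n).
  { intros n t. apply (geometric_cauchy (fun n => picard g xi x n (Rmax 0 t))).
    intros m. apply picard_step; [exact Hb|exact Hxi|]. apply Rmax_l. }
  assert (Hz : forall c eps, 0 < eps -> exists n, c * (1 / 2) ^ n < eps).
  { intros c eps He.
    destruct (pow_lt_1_zero (1 / 2)) with (y := eps / (Rabs c + 1)) as [n Hn].
    { rewrite Rabs_pos_eq; lra. }
    { apply Rdiv_lt_0_compat; [lra|]. assert (H := Rabs_pos c). lra. }
    exists n. specialize (Hn n (Nat.le_refl n)).
    assert (Hp : 0 < (1 / 2) ^ n) by (apply pow_lt; lra).
    rewrite Rabs_pos_eq in Hn by lra.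
    assert (Hc := Rabs_pos c). assert (Hc' := Rle_abs c).
    apply Rle_lt_trans with ((Rabs c + 1) * (1 / 2) ^ n); [nra|].
    apply Rlt_le_trans with ((Rabs c + 1) * (eps / (Rabs c + 1))).
    - apply Rmult_lt_compat_l; lra.
    - right. field. lra. }
  assert (Hllip : forall t s, Rabs (l t - l s) <= M * Rabs (t - s)).
  { intros t s. apply Rnot_lt_le. intros Hlt.
    set (e := Rabs (l t - l s) - M * Rabs (t - s)) in *.
    destruct (Hz (2 * (C (Rmax 0 t) + C (Rmax 0 s))) e) as [n Hn]; [unfold e; lra|].
    assert (H1 := Hl n t). assert (H2 := Hl n s).
    assert (H3 := picard_lipschitz g xi L M x n (Rmax 0 s) (Rmax 0 t) Hb Hxi).
    assert (H4 : Rabs (Rmax 0 t - Rmax 0 s) <= Rabs (t - s)).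
    { unfold Rmax. destruct (Rle_dec 0 t), (Rle_dec 0 s); unfold Rabs;
        repeat destruct Rcase_abs; lra. }
    assert (H5 : Rabs (l t - l s) <= Rabs (l t - picard g xi x n (Rmax 0 t))
       + Rabs (picard g xi x n (Rmax 0 t) - picard g xi x n (Rmax 0 s))
       + Rabs (l s - picard g xi x n (Rmax 0 s))).
    { rewrite (Rabs_minus_sym (l s)).
      replace (l t - l s) with ((l t - picard g xi x n (Rmax 0 t))
       + (picard g xi x n (Rmax 0 t) - picard g xi x n (Rmax 0 s))
       + (picard g xi x n (Rmax 0 s) - l s)) by ring.
      eapply Rle_trans; [apply Rabs_triang|]. apply Rplus_le_compat_r, Rabs_triang. }
    assert (M * Rabs (Rmax 0 t - Rmax 0 s) <= M * Rabs (t - s)) by nra.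
    unfold e in *. lra. }
  assert (Hlc : forall s, continuity_pt l s) by (apply lipschitz_continuous with M; exact Hllip).
  (* [l] freezes the limit at negative times, where the iterates need not
     converge; [y] is differentiable on both sides of 0 as well. *)
  set (y := fun t => x + RInt (fun s => g (l s - xi s)) 0 t).
  assert (Hyl : forall t, 0 <= t -> y t = l t).
  { intros t Ht. apply cond_eq. intros eps He.
    destruct (Hz (L * (2 * C t) * t + C t) eps He) as [n Hn].
    assert (H1 := Hl (S n) t). rewrite Rmax_right in H1 by exact Ht.
    assert (H2 : Rabs (y t - picard g xi x (S n) t) <= t * (L * (2 * C t * (1 / 2) ^ n))).
    { unfold y. cbn [picard].
      set (f1 := fun s => g (l s - xi s)).
      set (f2 := fun s => g (picard g xi x n s - xi s)).
      assert (E1 : ex_RInt f1 0 t)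
        by (apply continuous_ex_RInt, (field_continuous g xi L M); assumption).
      assert (E2 : ex_RInt f2 0 t).
      { apply continuous_ex_RInt, (field_continuous g xi L M); try assumption.
        intros s. apply (picard_continuous g xi L M); assumption. }
      assert (Hm : RInt (fun s => f1 s - f2 s) 0 t = RInt f1 0 t - RInt f2 0 t)
        by exact (RInt_minus f1 f2 0 t E1 E2).
      replace (x + RInt f1 0 t - (x + RInt f2 0 t)) with (RInt f1 0 t - RInt f2 0 t) by ring.
      rewrite <- Hm.
      replace (t * (L * (2 * C t * (1 / 2) ^ n))) with ((t - 0) * (L * (2 * C t * (1 / 2) ^ n))) by ring.
      apply abs_RInt_le_const; [exact Ht| |].
      - apply (ex_RInt_minus f1 f2); assumption.
      - intros s Hs. unfold f1, f2. eapply Rle_trans; [apply Hg|].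
        apply Rmult_le_compat_l; [lra|].
        match goal with |- Rabs ?e <= _ => replace e with (l s - picard g xi x n s) by ring end.
        assert (H3 := Hl n s). rewrite Rmax_right in H3 by lra.
        eapply Rle_trans; [exact H3|]. apply Rmult_le_compat_r; [apply pow_le; lra|].
        assert (H4 := HCinc s t). lra. }
    replace (y t - l t) with ((y t - picard g xi x (S n) t) + (picard g xi x (S n) t - l t)) by ring.
    eapply Rle_lt_trans; [apply Rabs_triang|]. rewrite (Rabs_minus_sym _ (l t)).
    simpl pow in H1. lra. }
  exists y. split.
  - unfold y. rewrite RInt_point. apply Rplus_0_r.
  - intros s Hs. rewrite (Hyl s Hs).
    apply (is_derive_primitive x (fun s => g (l s - xi s))).
    apply (field_continuous g xi L M); assumption.
Qed.

(** * One-sided derivatives *)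

Lemma is_derive_within_of_is_derive (D : R -> Prop) (f Y : R -> R) (s l rho : R) :
  D s -> 0 < rho -> (forall r, D r -> Rabs (r - s) < rho -> f r = Y r) ->
  is_derive Y s l -> is_derive_within (V := R_NormedModule) D f s l.
Proof.
  intros HDs Hrho Heq [Hlin Hdom]. split; [exact Hlin|].
  intros s' Hs'.
  assert (Hss : s = s').
  { apply @is_filter_lim_locally_unique. intros P HP.
    apply NNPP. intros Hn.
    destruct (Req_dec s s') as [->|Hne]; [apply Hn; exact HP|].
    assert (Hd : 0 < Rabs (s - s')) by (apply Rabs_pos_lt; lra).
    destruct (Hs' (fun r => Rabs (r - s') < Rabs (s - s'))) as [e He].
    { exists (mkposreal _ Hd). intros r Hr. exact Hr. }
    specialize (He s (ball_center s e) HDs). lra. }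
  subst s'. intros eps. destruct (Hdom s (fun P HP => HP) eps) as [e He].
  assert (Hm : 0 < Rmin e rho) by (apply Rmin_glb_lt; [apply cond_pos|exact Hrho]).
  exists (mkposreal _ Hm). intros r Hr HDr.
  assert (H1 : Rabs (r - s) < Rmin e rho) by exact Hr.
  rewrite (Heq r), (Heq s); [apply He|exact HDs| |exact HDr|].
  - apply Rlt_le_trans with (1 := H1), Rmin_l.
  - rewrite Rminus_diag, Rabs_R0. exact Hrho.
  - apply Rlt_le_trans with (1 := H1), Rmin_r.
Qed.

Lemma is_derive_of_is_derive_within (D : R -> Prop) (f : R -> R) (s l rho : R) :
  0 < rho -> (forall r, Rabs (r - s) < rho -> D r) ->
  is_derive_within (V := R_NormedModule) D f s l -> is_derive f s l.
Proof.
  intros Hrho HD [Hlin Hdom]. split; [exact Hlin|].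
  intros s' Hs'. assert (Hss : s = s') by (apply @is_filter_lim_locally_unique; exact Hs').
  subst s'. intros eps.
  destruct (Hdom s) with (eps := eps) as [e He].
  { intros P [e He]. exists e. intros r Hr _. apply He, Hr. }
  assert (Hm : 0 < Rmin e rho) by (apply Rmin_glb_lt; [apply cond_pos|exact Hrho]).
  exists (mkposreal _ Hm). intros r Hr.
  assert (H1 : Rabs (r - s) < Rmin e rho) by exact Hr.
  apply He.
  - apply Rlt_le_trans with (1 := H1), Rmin_l.
  - apply HD. apply Rlt_le_trans with (1 := H1), Rmin_r.
Qed.

Lemma is_derive_within_continuous (D : R -> Prop) (f : R -> R) (s l eps : R) :
  D s -> is_derive_within (V := R_NormedModule) D f s l -> 0 < eps ->
  exists rho, 0 < rho /\ forall r, D r -> Rabs (r - s) < rho -> Rabs (f r - f s) < eps.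
Proof.
  intros HDs Hd He.
  assert (HF : Filter (within D (locally s))) by apply within_filter, locally_filter.
  assert (Hc : filterlim f (within D (locally s)) (locally (f s))).
  { apply (filterdiff_continuous_aux (U := R_NormedModule) (V := R_NormedModule) (F := within D (locally s))).
    - eexists. exact Hd.
    - intros P [e HP]. exists e. intros r Hr _. apply HP, Hr. }
  destruct (Hc (fun v => Rabs (v - f s) < eps)) as [e H].
  { exists (mkposreal _ He). intros v Hv. exact Hv. }
  exists e. split; [apply cond_pos|]. intros r HDr Hr. apply H; [exact Hr|exact HDr].
Qed.

(** * The real flow to the right of the driver *)

(** Derivatives are required at interior times only, and continuity also at the
    end points: this is the regularity that mean value arguments use, and it is
    what one-sided derivatives provide. *)
Definition right_solution (xi : R -> R) (x t : R) (y : R -> R) : Prop :=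
  y 0 = x /\
  (forall s, 0 <= s <= t -> continuity_pt y s /\ xi s < y s) /\
  (forall s, 0 < s < t -> is_derive y s (-2 / (y s - xi s))).

Definition capped_solution (xi : R -> R) (x d : R) (y : R -> R) : Prop :=
  y 0 = x /\ forall s, 0 <= s -> is_derive y s (-2 / Rmax (y s - xi s) d).

Lemma capped_field_lipschitz (d : R) : 0 < d ->
  bounded_lipschitz (2 / (d * d)) (2 / d) (fun r => -2 / Rmax r d).
Proof.
  intros Hd.
  assert (Hdd : 0 < d * d) by nra.
  split; [apply Rdiv_lt_0_compat; lra|]. split.
  - intros r q. set (p1 := Rmax r d). set (p2 := Rmax q d).
    assert (H1 : d <= p1) by apply Rmax_r. assert (H2 : d <= p2) by apply Rmax_r.
    assert (H3 : Rabs (p1 - p2) <= Rabs (r - q)).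
    { unfold p1, p2, Rmax. destruct (Rle_dec r d), (Rle_dec q d); unfold Rabs;
        repeat destruct Rcase_abs; lra. }
    replace (-2 / p1 - -2 / p2) with (2 / (p1 * p2) * (p1 - p2)) by (field; lra).
    rewrite Rabs_mult. rewrite (Rabs_pos_eq (2 / _)).
    + apply Rmult_le_compat; [apply Rdiv_le_0_compat; nra|apply Rabs_pos| |exact H3].
      apply Rmult_le_compat_l; [lra|]. apply Rinv_le_contravar; nra.
    + apply Rdiv_le_0_compat; nra.
  - intros r. assert (H1 : d <= Rmax r d) by apply Rmax_r.
    replace (-2 / Rmax r d) with (- (2 / Rmax r d)) by (field; lra).
    rewrite Rabs_Ropp, Rabs_pos_eq.
    + apply Rmult_le_compat_l; [lra|]. apply Rinv_le_contravar; lra.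
    + apply Rdiv_le_0_compat; lra.
Qed.

(** Replacing the distance [r] to the driver by [Rmax r d] removes the
    singularity of the Loewner field, and the capped equation is solvable for
    all times. *)
Lemma capped_solution_exists (xi : R -> R) (x d : R) :
  (forall s, continuity_pt xi s) -> 0 < d -> exists y, capped_solution xi x d y.
Proof.
  intros Hxi Hd.
  exact (picard_exists _ xi _ _ x (capped_field_lipschitz d Hd) Hxi).
Qed.

Lemma capped_solution_continuous (xi : R -> R) (x d : R) (y : R -> R) (s : R) :
  capped_solution xi x d y -> 0 <= s -> continuity_pt y s.
Proof. intros [_ H] Hs. eapply derive_continuity_pt. apply H, Hs. Qed.

Lemma capped_right_solution (xi : R -> R) (x d t : R) (y : R -> R) :
  0 < d -> capped_solution xi x d y -> (forall s, 0 <= s <= t -> d <= y s - xi s) ->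
  right_solution xi x t y.
Proof.
  intros Hd Hy Hgap. assert (Hy' := Hy). destruct Hy' as [H0 Hder]. split; [exact H0|]. split.
  - intros s Hs. split; [eapply capped_solution_continuous; [exact Hy|lra]|].
    specialize (Hgap s Hs). lra.
  - intros s Hs. rewrite <- (Rmax_left (y s - xi s) d) by (apply Hgap; lra).
    apply Hder. lra.
Qed.

(** While the distance to the driver is at least [d] the Loewner equation and its
    capped version coincide, so uniqueness for the Lipschitz field identifies
    the two solutions. *)
Lemma right_solution_capped (xi : R -> R) (x d t : R) (y Y : R -> R) :
  0 < d -> right_solution xi x t y -> (forall s, 0 <= s <= t -> d <= y s - xi s) ->
  capped_solution xi x d Y -> forall s, 0 <= s <= t -> y s = Y s.
Proof.
  intros Hd [Hy0 [Hyc Hyd]] Hgap HY s Hs.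
  assert (HY' := HY). destruct HY' as [HY0 HYd].
  destruct (capped_field_lipschitz d Hd) as [_ [Hlip _]].
  cut (y s - Y s = 0); [lra|].
  apply (gronwall_zero (fun r => y r - Y r)
    (fun r => -2 / (y r - xi r) - -2 / Rmax (Y r - xi r) d) (2 / (d * d)) s); [lra| | | |lra].
  - intros r Hr. apply continuity_pt_minus; [apply Hyc; lra|].
    eapply capped_solution_continuous; [exact HY|lra].
  - intros r Hr. apply @is_derive_minus; [apply Hyd; lra|apply HYd; lra].
  - intros r Hr.
    assert (Hm : Rmax (y r - xi r) d = y r - xi r) by (apply Rmax_left, Hgap; lra).
    specialize (Hlip (y r - xi r) (Y r - xi r)). cbv beta in Hlip. rewrite Hm in Hlip.
    replace (y r - xi r - (Y r - xi r)) with (y r - Y r) in Hlip by ring. exact Hlip.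
Qed.

Lemma right_solution_le (xi : R -> R) (x s t : R) (y : R -> R) :
  s <= t -> right_solution xi x t y -> right_solution xi x s y.
Proof.
  intros Hst [H0 [Hc Hd]]. split; [exact H0|].
  split; intros r Hr; [apply Hc|apply Hd]; lra.
Qed.

Lemma right_solution_gap (xi : R -> R) (x t : R) (y : R -> R) :
  (forall s, continuity_pt xi s) -> 0 <= t -> right_solution xi x t y ->
  exists d, 0 < d /\ forall s, 0 <= s <= t -> d <= y s - xi s.
Proof.
  intros Hxi Ht [_ [Hc _]].
  destruct (continuity_ab_min (fun s => y s - xi s) 0 t Ht) as [m [Hm1 Hm2]].
  { intros s Hs. apply continuity_pt_minus; [apply Hc, Hs|apply Hxi]. }
  exists (y m - xi m). split; [|exact Hm1]. destruct (Hc m Hm2). lra.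
Qed.

Lemma right_solution_unique (xi : R -> R) (x t : R) (y z : R -> R) :
  (forall s, continuity_pt xi s) -> right_solution xi x t y -> right_solution xi x t z ->
  forall s, 0 <= s <= t -> y s = z s.
Proof.
  intros Hxi Hy Hz s Hs.
  destruct (right_solution_gap xi x t y Hxi ltac:(lra) Hy) as [d1 [Hd1 H1]].
  destruct (right_solution_gap xi x t z Hxi ltac:(lra) Hz) as [d2 [Hd2 H2]].
  assert (Hd : 0 < Rmin d1 d2) by (apply Rmin_glb_lt; assumption).
  destruct (capped_solution_exists xi x _ Hxi Hd) as [Y HY].
  transitivity (Y s); [|symmetry];
    eapply right_solution_capped; [exact Hd|exact Hy| |exact HY|exact Hs
                                  |exact Hd|exact Hz| |exact HY|exact Hs].
  - intros r Hr. eapply Rle_trans; [apply Rmin_l|apply H1, Hr].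
  - intros r Hr. eapply Rle_trans; [apply Rmin_r|apply H2, Hr].
Qed.

Lemma right_solution_at_0 (xi : R -> R) (x : R) :
  xi 0 < x -> right_solution xi x 0 (fun _ => x).
Proof.
  intros Hx. split; [reflexivity|]. split; [|intros s Hs; lra].
  intros s Hs. replace s with 0 by lra. split; [|exact Hx].
  apply continuity_pt_const. intros p q. reflexivity.
Qed.

(** Solutions are unique but obtained separately on each closed time interval;
    taking the infimum of their possible values joins them into one function
    without choosing among them. *)
Definition trajectory (xi : R -> R) (x t : R) : R :=
  real (Glb_Rbar (fun v => exists y, right_solution xi x t y /\ v = y t)).

(** The infimum is over a single value, by uniqueness. *)
Lemma trajectory_eq (xi : R -> R) (x t : R) (y : R -> R) :
  (forall s, continuity_pt xi s) -> right_solution xi x t y ->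
  forall s, 0 <= s <= t -> trajectory xi x s = y s.
Proof.
  intros Hxi Hy s Hs. unfold trajectory.
  rewrite (is_glb_Rbar_unique _ (y s)); [reflexivity|].
  assert (Hys := right_solution_le xi x s t y (proj2 Hs) Hy).
  split.
  - intros v [z [Hz ->]]. right.
    apply (right_solution_unique xi x s y z Hxi Hys Hz). lra.
  - intros b Hb. apply Hb. exists y. split; [exact Hys|reflexivity].
Qed.

(** * Hitting times of the flow *)

(** The hitting time as a relation, before any infimum is taken: solutions are
    unique, so at most one [t] up to the final time of the driver is related to
    a given [x]. *)
Definition hits (xi : R -> R) (x t : R) : Prop :=
  0 < t /\ exists y, real_upward_solution xi t x y /\
    forall eps u, 0 < eps -> u < t ->
      exists s, 0 <= s /\ u < s < t /\ Rabs (y s - xi s) < eps.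

Lemma trajectory_real_upward_solution (xi : R -> R) (x r : R) :
  (forall s, continuity_pt xi s) -> xi 0 < x ->
  (forall q, 0 <= q < r -> exists y, right_solution xi x q y) ->
  real_upward_solution xi r x (trajectory xi x).
Proof.
  intros Hxi Hx Hall. split.
  - rewrite (trajectory_eq xi x 0 _ Hxi (right_solution_at_0 xi x Hx) 0); lra.
  - intros s Hs. set (q := (s + r) / 2).
    destruct (Hall q) as [y Hy]; [unfold Ico in Hs; unfold q; lra|].
    destruct (right_solution_gap xi x q y Hxi) as [d [Hd Hgap]]; [unfold Ico in Hs; unfold q; lra|exact Hy|].
    destruct (capped_solution_exists xi x d Hxi Hd) as [Y HY].
    assert (HyY := right_solution_capped xi x d q y Y Hd Hy Hgap HY).
    assert (Hq : 0 <= s < q) by (unfold Ico in Hs; unfold q; lra).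
    assert (Hs1 : trajectory xi x s = Y s).
    { rewrite (trajectory_eq xi x q y Hxi Hy) by lra. apply HyY. lra. }
    assert (Hgs : d <= Y s - xi s) by (rewrite <- HyY by lra; apply Hgap; lra).
    split; [lra|].
    apply (is_derive_within_of_is_derive (Ico 0 r) _ Y s _ (q - s)); [exact Hs|lra| |].
    + intros p Hp Hps. unfold Ico in Hp. apply Rabs_def2 in Hps.
      rewrite (trajectory_eq xi x q y Hxi Hy) by lra. apply HyY. lra.
    + rewrite Hs1. rewrite <- (Rmax_left (Y s - xi s) d) by lra. apply HY. lra.
Qed.

(** The existence theorem for the singular equation. Along an interval, a
    solution up to time [r] keeps a positive distance from the driver and
    continues as a capped solution. If solutions exist up to every time before
    [r] and [r] is not a hitting time, then the trajectory keeps a positive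
    distance [eps] from the driver near [r], hence some positive distance on the
    whole of [[0, r)], and a single capped solution covers [[0, r]]. *)
Lemma hit_or_survive (xi : R -> R) (x t : R) :
  (forall s, continuity_pt xi s) -> xi 0 < x -> 0 <= t ->
  (exists t', t' <= t /\ hits xi x t') \/ (exists y, right_solution xi x t y).
Proof.
  intros Hxi Hx Ht.
  destruct (classic (exists t', t' <= t /\ hits xi x t')) as [Hh|Hno]; [left; exact Hh|right].
  apply (real_induction (fun r => exists y, right_solution xi x r y) 0 t); [exact Ht| | | |lra].
  - exists (fun _ => x). apply right_solution_at_0, Hx.
  - intros r Hr IH. destruct (IH r) as [y Hy]; [lra|].
    destruct (right_solution_gap xi x r y Hxi ltac:(lra) Hy) as [d [Hd Hgap]].
    assert (Hd2 : 0 < d / 2) by lra.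
    destruct (capped_solution_exists xi x _ Hxi Hd2) as [Y HY].
    assert (HyY : forall s, 0 <= s <= r -> y s = Y s).
    { apply right_solution_capped with xi x (d / 2); try assumption.
      intros s Hs. specialize (Hgap s Hs). lra. }
    destruct (continuity_pt_gt (fun s => Y s - xi s) r (d / 2)) as [rho [Hrho Hq]].
    { apply continuity_pt_minus; [|apply Hxi].
      eapply capped_solution_continuous; [exact HY|lra]. }
    { rewrite <- HyY by lra. specialize (Hgap r ltac:(lra)). lra. }
    exists (rho / 2). split; [lra|]. intros q Hq1 Hq2. exists Y.
    apply capped_right_solution with (d / 2); [exact Hd2|exact HY|].
    intros s Hs. destruct (Rle_dec s r).
    + rewrite <- HyY by lra. specialize (Hgap s ltac:(lra)). lra.
    + left. apply Hq. apply Rabs_def1; lra.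
  - intros r Hr IH.
    assert (Hsol := trajectory_real_upward_solution xi x r Hxi Hx IH).
    assert (Hgap : exists eps u, 0 < eps /\ u < r /\
      forall s, 0 <= s -> u < s < r -> eps <= Rabs (trajectory xi x s - xi s)).
    { apply NNPP. intros Hn. apply Hno. exists r. split; [lra|]. split; [lra|].
      exists (trajectory xi x). split; [exact Hsol|]. intros eps u He Hu.
      apply NNPP. intros Hn2. apply Hn. exists eps, u. split; [exact He|]. split; [exact Hu|].
      intros s Hs0 Hs. apply Rnot_lt_le. intros Hlt. apply Hn2. exists s. auto. }
    destruct Hgap as [eps [u [He [Hu Hgap]]]].
    set (m := (Rmax 0 u + r) / 2).
    assert (Hm : 0 <= m < r /\ u < m).
    { assert (0 <= Rmax 0 u) by apply Rmax_l. assert (u <= Rmax 0 u) by apply Rmax_r.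
      assert (Rmax 0 u < r) by (apply Rmax_lub_lt; lra). unfold m. lra. }
    destruct (IH m) as [y0 Hy0]; [lra|].
    destruct (right_solution_gap xi x m y0 Hxi ltac:(lra) Hy0) as [d0 [Hd0 Hgap0]].
    set (d := Rmin d0 eps).
    assert (Hd : 0 < d) by (apply Rmin_glb_lt; assumption).
    assert (Hdd0 : d <= d0) by apply Rmin_l. assert (Hde : d <= eps) by apply Rmin_r.
    destruct (capped_solution_exists xi x d Hxi Hd) as [Y HY].
    exists Y. apply capped_right_solution with d; [exact Hd|exact HY|].
    assert (HYgap : forall q, 0 <= q < r -> d <= Y q - xi q).
    { intros q Hq. destruct (IH q Hq) as [y Hy].
      assert (Hyg : forall s, 0 <= s <= q -> d <= y s - xi s).
      { intros s Hs. rewrite <- (trajectory_eq xi x q y Hxi Hy s Hs).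
        destruct (Rle_dec s m).
        - rewrite (trajectory_eq xi x m y0 Hxi Hy0 s) by lra.
          specialize (Hgap0 s ltac:(lra)). lra.
        - specialize (Hgap s ltac:(lra) ltac:(lra)). revert Hgap.
          rewrite (trajectory_eq xi x q y Hxi Hy s Hs).
          destruct Hy as [_ [Hy _]]. destruct (Hy s Hs) as [_ Hpos].
          rewrite Rabs_pos_eq; lra. }
      rewrite <- (right_solution_capped xi x d q y Y Hd Hy Hyg HY q) by lra.
      apply Hyg. lra. }
    intros s Hs. destruct (Req_dec s r) as [->|]; [|apply HYgap; lra].
    apply (continuity_pt_left_ge (fun q => Y q - xi q) 0 r d); [lra| |exact HYgap].
    apply continuity_pt_minus; [|apply Hxi]. eapply capped_solution_continuous; [exact HY|lra].
Qed.

(** A solution that avoids the driver stays on its side, by the intermediate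
    value theorem. Composing with [Rmax 0] makes the one-sided continuity at
    time 0 two-sided. *)
Lemma right_solution_of_real_upward_solution (xi : R -> R) (x t : R) (y : R -> R) :
  (forall s, continuity_pt xi s) -> xi 0 < x -> real_upward_solution xi t x y ->
  forall q, 0 <= q < t -> right_solution xi x q (fun s => y (Rmax 0 s)).
Proof.
  intros Hxi Hx [Hy0 Hy].
  assert (Hc : forall s, 0 <= s < t -> continuity_pt (fun s => y (Rmax 0 s)) s).
  { intros s Hs eps He. destruct (Hy s Hs) as [_ Hd].
    destruct (is_derive_within_continuous _ _ _ _ _ Hs Hd He) as [rho [Hrho H]].
    exists (Rmin rho (t - s)). split; [apply Rmin_glb_lt; lra|].
    intros p [_ Hp]. simpl in *. unfold R_dist in *.
    assert (Hp1 : Rabs (p - s) < rho) by (eapply Rlt_le_trans; [exact Hp|apply Rmin_l]).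
    assert (Hp2 : Rabs (p - s) < t - s) by (eapply Rlt_le_trans; [exact Hp|apply Rmin_r]).
    apply Rabs_def2 in Hp1, Hp2.
    rewrite (Rmax_right 0 s) by lra. apply H.
    - split; [apply Rmax_l|]. apply Rmax_lub_lt; lra.
    - unfold Rmax. destruct (Rle_dec 0 p); apply Rabs_def1; lra. }
  assert (Hpos : forall s, 0 <= s < t -> xi s < y (Rmax 0 s)).
  { intros s Hs. apply Rnot_le_lt. intros Hle.
    assert (Hne : forall r, 0 <= r < t -> y (Rmax 0 r) - xi r <> 0).
    { intros r Hr. rewrite Rmax_right by lra. destruct (Hy r Hr) as [H _]. lra. }
    assert (Hs0 : 0 < s).
    { destruct (Req_dec s 0) as [->|]; [|lra]. rewrite Rmax_right, Hy0 in Hle; lra. }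
    destruct (IVT_interv (fun r => - (y (Rmax 0 r) - xi r)) 0 s) as [z [Hz1 Hz2]].
    - intros r Hr. apply continuity_pt_opp, continuity_pt_minus; [apply Hc; lra|apply Hxi].
    - exact Hs0.
    - rewrite Rmax_right, Hy0; lra.
    - specialize (Hne s Hs). lra.
    - apply (Hne z); lra. }
  intros q Hq. split; [rewrite Rmax_right; [exact Hy0|lra]|]. split.
  - intros s Hs. split; [apply Hc|apply Hpos]; lra.
  - intros s Hs. rewrite Rmax_right by lra.
    apply is_derive_ext_loc with y.
    { exists (mkposreal s (proj1 Hs)). intros r Hr. change (Rabs (r - s) < s) in Hr.
      apply Rabs_def2 in Hr. rewrite Rmax_right; [reflexivity|lra]. }
    destruct (Hy s) as [_ Hd]; [split; lra|].
    apply is_derive_of_is_derive_within with (Ico 0 t) (Rmin s (t - s)).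
    + apply Rmin_glb_lt; lra.
    + intros r Hr.
      assert (Hp1 : Rabs (r - s) < s) by (eapply Rlt_le_trans; [exact Hr|apply Rmin_l]).
      assert (Hp2 : Rabs (r - s) < t - s) by (eapply Rlt_le_trans; [exact Hr|apply Rmin_r]).
      apply Rabs_def2 in Hp1, Hp2. split; lra.
    + exact Hd.
Qed.

Lemma hits_right (xi : R -> R) (x t : R) :
  (forall s, continuity_pt xi s) -> xi 0 < x -> hits xi x t ->
  exists y, (forall q, 0 <= q < t -> right_solution xi x q y) /\
    forall eps, 0 < eps -> exists s, 0 <= s < t /\ y s - xi s < eps.
Proof.
  intros Hxi Hx [Ht [y [Hy Hh]]]. exists (fun s => y (Rmax 0 s)). split.
  - apply right_solution_of_real_upward_solution; assumption.
  - intros eps He. destruct (Hh eps 0 He Ht) as [s [Hs0 [Hs Hlt]]].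
    exists s. split; [lra|]. rewrite Rmax_right by lra.
    apply Rabs_def2 in Hlt. lra.
Qed.

(** A solution that hits at the later time is still at a positive distance from
    the driver at the earlier one, and the two solutions agree until then. *)
Lemma hits_unique_right (xi : R -> R) (x t1 t2 : R) :
  (forall s, continuity_pt xi s) -> xi 0 < x -> hits xi x t1 -> hits xi x t2 -> t1 = t2.
Proof.
  intros Hxi Hx.
  assert (W : forall t1 t2, hits xi x t1 -> hits xi x t2 -> t1 < t2 -> False).
  { clear t1 t2. intros t1 t2 H1 H2 Hlt.
    assert (Ht1 : 0 < t1) by apply H1.
    destruct (hits_right xi x t1 Hxi Hx H1) as [y [Hy Hy']].
    destruct (hits_right xi x t2 Hxi Hx H2) as [z [Hz _]].
    assert (Hz1 : right_solution xi x t1 z) by (apply Hz; lra).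
    destruct (right_solution_gap xi x t1 z Hxi ltac:(lra) Hz1) as [d [Hd Hgap]].
    destruct (Hy' d Hd) as [s [Hs Hlts]].
    rewrite (right_solution_unique xi x s y z Hxi) in Hlts.
    - specialize (Hgap s ltac:(lra)). lra.
    - apply Hy, Hs.
    - apply Hz. lra.
    - lra. }
  intros H1 H2. destruct (Rtotal_order t1 t2) as [Hlt|[Heq|Hlt]]; [|exact Heq|];
    exfalso; eapply W; [exact H1|exact H2|exact Hlt|exact H2|exact H1|exact Hlt].
Qed.

(** The central estimate. Where [z - y > e] the point [z] is farther from [eta]
    than [y] is from [xi], so [z] is pulled to the left more slowly than [y] and
    the gap [z - y] does not shrink. *)
Lemma right_solution_compare (xi eta : R -> R) (x x' e t : R) (y z : R -> R) :
  0 <= t -> (forall s, 0 <= s <= t -> eta s <= xi s + e) -> e < x - x' ->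
  right_solution xi x' t y -> right_solution eta x t z ->
  x - x' <= z t - y t.
Proof.
  intros Ht He Hex [Hy0 [Hyc Hyd]] [Hz0 [Hzc Hzd]].
  rewrite <- Hy0, <- Hz0.
  apply (barrier (fun s => z s - y s)
    (fun s => -2 / (z s - eta s) - -2 / (y s - xi s)) e t); [exact Ht| | | |lra].
  - intros r Hr. apply continuity_pt_minus; [apply Hzc|apply Hyc]; lra.
  - intros r Hr. apply @is_derive_minus; [apply Hzd|apply Hyd]; lra.
  - intros r Hr Hw. specialize (He r ltac:(lra)).
    destruct (Hyc r) as [_ H1]; [lra|]. destruct (Hzc r) as [_ H2]; [lra|].
    assert (H3 : / (z r - eta r) <= / (y r - xi r)) by (apply Rinv_le_contravar; lra).
    unfold Rdiv. lra.
Qed.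

(** If [xi] did not catch [x'] by time [t], the solution from [x'] would keep
    some distance [d] from [xi] on [[0, t]], and the solution from [x], which
    stays to its right by more than [eta] exceeds [xi], would keep at least this
    distance from [eta]. *)
Lemma hits_compare_right (xi eta : R -> R) (x x' e t : R) :
  (forall s, continuity_pt xi s) -> (forall s, continuity_pt eta s) ->
  (forall s, 0 <= s <= t -> eta s <= xi s + e) -> e < x - x' ->
  xi 0 < x' -> hits eta x t -> exists t', t' <= t /\ hits xi x' t'.
Proof.
  intros Hxi Heta He Hex Hx' Hh. assert (Ht : 0 < t) by apply Hh.
  assert (Hx : eta 0 < x) by (specialize (He 0 ltac:(lra)); lra).
  destruct (hit_or_survive xi x' t Hxi Hx' ltac:(lra)) as [H|[y Hy]]; [exact H|exfalso].
  destruct (right_solution_gap xi x' t y Hxi ltac:(lra) Hy) as [d [Hd Hgap]].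
  destruct (hits_right eta x t Heta Hx Hh) as [z [Hz Hz']].
  destruct (Hz' d Hd) as [s [Hs Hlt]].
  assert (Hc := right_solution_compare xi eta x x' e s y z (proj1 Hs)
    (fun r Hr => He r ltac:(lra)) Hex
    (right_solution_le xi x' s t y ltac:(lra) Hy) (Hz s Hs)).
  specialize (He s ltac:(lra)). specialize (Hgap s ltac:(lra)). lra.
Qed.

(** The gap between the two solutions never drops below its initial value, so
    the outer one cannot be caught while the inner one is still moving. *)
Lemma hits_increasing_right (xi : R -> R) (x x' t t' : R) :
  (forall s, continuity_pt xi s) -> xi 0 < x' -> x' < x ->
  hits xi x' t' -> hits xi x t -> t' < t.
Proof.
  intros Hxi Hx' Hlt Hh' Hh. apply Rnot_le_lt. intros Hle.
  destruct (hits_right xi x t Hxi ltac:(lra) Hh) as [z [Hz Hz']].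
  destruct (hits_right xi x' t' Hxi Hx' Hh') as [y [Hy _]].
  destruct (Hz' (x - x')) as [s [Hs Hs']]; [lra|].
  assert (Hys : right_solution xi x' s y) by (apply Hy; lra).
  assert (Hc := right_solution_compare xi xi x x' 0 s y z (proj1 Hs)
    (fun r _ => ltac:(lra)) ltac:(lra) Hys (Hz s Hs)).
  destruct Hys as [_ [Hyc _]]. destruct (Hyc s) as [_ H]; lra.
Qed.

(** * Drivers on a compact time interval *)

(** Drivers are continuous on [[0, T]] only; freezing them at the end points makes
    them continuous on the line. *)
Definition frozen_outside (a b : R) (f : R -> R) (s : R) : R := f (Rmax a (Rmin b s)).

Lemma frozen_outside_eq (a b : R) (f : R -> R) (s : R) :
  a <= s <= b -> frozen_outside a b f s = f s.
Proof. intros Hs. unfold frozen_outside. rewrite Rmin_right, Rmax_right; lra. Qed.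

Lemma frozen_outside_continuous (a b : R) (f : R -> R) :
  a <= b -> continuous_on (U := R_UniformSpace) (Icc a b) f ->
  forall s, continuity_pt (frozen_outside a b f) s.
Proof.
  intros Hab Hf s eps He. unfold frozen_outside.
  assert (Hin : forall p, Icc a b (Rmax a (Rmin b p))).
  { intros p. split; [apply Rmax_l|]. apply Rmax_lub; [exact Hab|apply Rmin_l]. }
  destruct (Hf _ (Hin s) (fun v => Rabs (v - f (Rmax a (Rmin b s))) < eps)) as [rho H].
  { exists (mkposreal _ He). intros v Hv. exact Hv. }
  exists rho. split; [apply cond_pos|]. intros p [_ Hp]. simpl in *. unfold R_dist in *.
  apply H; [|apply Hin]. eapply Rle_lt_trans; [|exact Hp].
  change (Rabs (Rmax a (Rmin b p) - Rmax a (Rmin b s)) <= Rabs (p - s)).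
  unfold Rmax, Rmin. destruct (Rle_dec b p), (Rle_dec b s); repeat destruct Rle_dec;
    unfold Rabs; repeat destruct Rcase_abs; lra.
Qed.

Lemma hits_ext (xi eta : R -> R) (x t : R) :
  (forall s, 0 <= s < t -> eta s = xi s) -> hits xi x t -> hits eta x t.
Proof.
  intros Heq [Ht [y [[Hy0 Hy] Hh]]]. split; [exact Ht|]. exists y. split.
  - split; [exact Hy0|]. intros s Hs. rewrite (Heq s Hs). apply Hy, Hs.
  - intros eps u He Hu. destruct (Hh eps u He Hu) as [s [Hs0 [Hs Hlt]]].
    exists s. rewrite Heq by lra. auto.
Qed.

(** * Reflection *)

(** The flow is symmetric under reflection in 0; this reduces starting points to
    the left of the driver to those to its right. *)
Lemma hits_opp (xi : R -> R) (x t : R) :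
  hits xi x t -> hits (fun s => - xi s) (- x) t.
Proof.
  intros [Ht [y [[Hy0 Hy] Hh]]]. split; [exact Ht|]. exists (fun s => - y s). split.
  - split; [rewrite Hy0; reflexivity|]. intros s Hs. destruct (Hy s Hs) as [Hne Hd].
    split; [lra|].
    assert (HF : Filter (within (Ico 0 t) (locally s))) by apply within_filter, locally_filter.
    assert (H := filterdiff_opp_fct y _ Hd).
    apply filterdiff_ext_lin with (1 := H).
    intros u. unfold opp, scal; simpl. unfold mult; simpl. field. split; lra.
  - intros eps u He Hu. destruct (Hh eps u He Hu) as [s [Hs0 [Hs Hlt]]].
    exists s. split; [exact Hs0|]. split; [exact Hs|].
    replace (- y s - - xi s) with (- (y s - xi s)) by ring. rewrite Rabs_Ropp. exact Hlt.
Qed.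

Lemma hits_opp_inv (xi : R -> R) (x t : R) :
  hits (fun s => - xi s) (- x) t -> hits xi x t.
Proof.
  intros H. apply hits_opp in H. rewrite Ropp_involutive in H.
  apply hits_ext with (2 := H). intros s _. ring.
Qed.

(** * The hitting time function *)

Lemma liminf_left_eq_0 (f : R -> R) (t : R) :
  (forall s, 0 <= f s) -> 0 <= t ->
  liminf_left f t = Finite 0 <->
  0 < t /\ forall eps u, 0 < eps -> u < t -> exists s, 0 <= s /\ u < s < t /\ f s < eps.
Proof.
  intros Hf Ht. unfold liminf_left, Rbar_lub.
  match goal with |- context [Rbar_ex_lub ?E] => destruct (Rbar_ex_lub E) as [l [Hub Hlub]] end.
  simpl. split.
  - intros ->.
    assert (Ht0 : 0 < t).
    { destruct (Req_dec t 0) as [->|]; [exfalso|lra].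
      apply (Hlub m_infty). intros m [u [Hu _]]. lra. }
    split; [exact Ht0|]. intros eps u He Hu. apply NNPP. intros Hn.
    assert (Hu' : 0 <= Rmax 0 u < t) by (split; [apply Rmax_l|apply Rmax_lub_lt; lra]).
    assert (H := Hub _ (ex_intro _ (Rmax 0 u) (conj Hu' eq_refl))).
    match type of H with Rbar_le (Glb_Rbar ?E) _ => destruct (Glb_Rbar_correct E) as [_ Hglb] end.
    assert (H2 : Rbar_le eps 0).
    { eapply Rbar_le_trans; [apply Hglb|exact H]. intros v [s [Hs ->]].
      simpl. apply Rnot_lt_le. intros Hlt. apply Hn. exists s.
      assert (0 <= Rmax 0 u) by apply Rmax_l. assert (u <= Rmax 0 u) by apply Rmax_r.
      repeat split; lra. }
    simpl in H2. lra.
  - intros [Ht0 Hh].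
    assert (HG : forall u, 0 <= u < t ->
      Glb_Rbar (fun v => exists s, u < s < t /\ v = f s) = Finite 0).
    { intros u Hu. apply is_glb_Rbar_unique. split.
      - intros v [s [_ ->]]. apply Hf.
      - intros b Hb. destruct b as [b| |]; simpl; [|exfalso|exact I].
        + apply Rnot_lt_le. intros Hlt. destruct (Hh b u Hlt (proj2 Hu)) as [s [_ [Hs Hs']]].
          assert (H := Hb (f s) (ex_intro _ s (conj Hs eq_refl))). simpl in H. lra.
        + destruct (Hh 1 u Rlt_0_1 (proj2 Hu)) as [s [_ [Hs _]]].
          exact (Hb (f s) (ex_intro _ s (conj Hs eq_refl))). }
    apply Rbar_le_antisym.
    + apply Hlub. intros m [u [Hu ->]]. rewrite (HG u Hu). apply Rbar_le_refl.
    + rewrite <- (HG 0) by lra. apply Hub. exists 0. split; [lra|reflexivity].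
Qed.

Lemma hits_iff (T : R) (xi : R -> R) (x t : R) :
  (Icc 0 T t /\ exists y, real_upward_solution xi t x y /\
     liminf_left (fun s => Rabs (y s - xi s)) t = Finite 0) <-> t <= T /\ hits xi x t.
Proof.
  split.
  - intros [[H0 HT] [y [Hy Hl]]]. apply liminf_left_eq_0 in Hl; [|intros; apply Rabs_pos|exact H0].
    split; [exact HT|]. split; [apply Hl|]. exists y. split; [exact Hy|apply Hl].
  - intros [HT [Ht [y [Hy Hl]]]]. split; [split; lra|]. exists y. split; [exact Hy|].
    apply liminf_left_eq_0; [intros; apply Rabs_pos|lra|split; assumption].
Qed.

Lemma driver_opp (T : R) (xi : R -> R) : driver T xi -> driver T (fun s => - xi s).
Proof.
  intros H s Hs. eapply filterlim_comp; [apply H, Hs|]. apply (filterlim_opp (V := R_NormedModule)).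
Qed.

Lemma frozen_hits (T : R) (xi : R -> R) (x t : R) :
  t <= T -> hits (frozen_outside 0 T xi) x t <-> hits xi x t.
Proof.
  intros HT. split; apply hits_ext; intros s Hs; rewrite frozen_outside_eq; auto; lra.
Qed.

Lemma hits_unique (T : R) (xi : R -> R) (x t1 t2 : R) :
  driver T xi -> x <> xi 0 -> t1 <= T -> t2 <= T -> hits xi x t1 -> hits xi x t2 -> t1 = t2.
Proof.
  assert (W : forall xi x, driver T xi -> xi 0 < x -> t1 <= T -> t2 <= T ->
    hits xi x t1 -> hits xi x t2 -> t1 = t2).
  { clear xi x. intros xi x Hxi Hx H1 H2 Hh1 Hh2. assert (0 < t1) by apply Hh1.
    apply (hits_unique_right (frozen_outside 0 T xi) x).
    - apply frozen_outside_continuous; [lra|exact Hxi].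
    - rewrite frozen_outside_eq; lra.
    - apply frozen_hits; assumption.
    - apply frozen_hits; assumption. }
  intros Hxi Hx H1 H2 Hh1 Hh2. destruct (Rlt_dec (xi 0) x).
  - apply (W xi x); assumption.
  - apply (W (fun s => - xi s) (- x)); try assumption.
    + apply driver_opp, Hxi.
    + lra.
    + apply hits_opp, Hh1.
    + apply hits_opp, Hh2.
Qed.

Lemma hitting_time_finite_iff (T : R) (xi : R -> R) (x t : R) :
  driver T xi -> x <> xi 0 ->
  hitting_time T xi x = Finite t <-> t <= T /\ hits xi x t.
Proof.
  intros Hxi Hx. unfold hitting_time. destruct (Req_dec_T x (xi 0)) as [E|_]; [contradiction|].
  assert (Hsuff : forall t, t <= T /\ hits xi x t -> is_glb_Rbar (fun t : R =>
    Icc 0 T t /\ exists y : R -> R, real_upward_solution xi t x y /\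
      liminf_left (fun s : R => Rabs (y s - xi s)) t = Finite 0) t).
  { clear t. intros t Ht. split.
    - intros t' Ht'. apply hits_iff in Ht'. right.
      apply (hits_unique T xi x); tauto.
    - intros b Hb. apply Hb. apply hits_iff, Ht. }
  split.
  - intros Hg. destruct (classic (exists t', t' <= T /\ hits xi x t')) as [[t' Ht']|Hn].
    + rewrite (is_glb_Rbar_unique _ _ (Hsuff t' Ht')) in Hg. injection Hg as <-. exact Ht'.
    + exfalso. match type of Hg with Glb_Rbar ?E = _ =>
        destruct (Glb_Rbar_correct E) as [_ Hglb] end.
      rewrite Hg in Hglb. apply (Hglb p_infty). intros t' Ht'. apply hits_iff in Ht'.
      apply Hn. exists t'. exact Ht'.
  - intros Ht. apply is_glb_Rbar_unique, Hsuff, Ht.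
Qed.

Lemma hitting_time_start (T : R) (xi : R -> R) : hitting_time T xi (xi 0) = Finite 0.
Proof. unfold hitting_time. destruct (Req_dec_T (xi 0) (xi 0)); [reflexivity|contradiction]. Qed.

Lemma hitting_time_pos (T : R) (xi : R -> R) (x t : R) :
  driver T xi -> x <> xi 0 -> hitting_time T xi x = Finite t -> 0 < t.
Proof. intros Hxi Hx H. apply hitting_time_finite_iff in H; auto. apply H. Qed.

Lemma hitting_time_nonneg (T : R) (xi : R -> R) (x t : R) :
  driver T xi -> hitting_time T xi x = Finite t -> 0 <= t.
Proof.
  intros Hxi H. destruct (Req_dec x (xi 0)) as [->|Hne].
  - rewrite hitting_time_start in H. injection H as <-. lra.
  - left. eapply hitting_time_pos; eassumption.
Qed.

Lemma hitting_time_opp (T : R) (xi : R -> R) (x : R) (t : R) :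
  driver T xi ->
  hitting_time T (fun s => - xi s) (- x) = Finite t <-> hitting_time T xi x = Finite t.
Proof.
  intros Hxi. destruct (Req_dec x (xi 0)) as [->|Hne].
  - rewrite (hitting_time_start T xi).
    assert (H := hitting_time_start T (fun s => - xi s)). cbv beta in H. rewrite H. tauto.
  - rewrite (hitting_time_finite_iff T xi x t Hxi Hne).
    rewrite (hitting_time_finite_iff T (fun s => - xi s) (- x) t (driver_opp T xi Hxi)) by lra.
    split; intros [HT H]; (split; [exact HT|]); [apply hits_opp_inv|apply hits_opp]; exact H.
Qed.

(** * Comparison of hitting times *)

(** A bound on the difference of two drivers becomes an inequality between hitting
    times. The point [x'] may be the starting point of [xi], whose hitting time
    is 0 by definition. *)
Lemma hitting_time_compare_right (T : R) (xi eta : R -> R) (x x' e t : R) :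
  driver T xi -> driver T eta -> (forall s, Icc 0 T s -> eta s <= xi s + e) ->
  0 <= T -> e < x - x' -> xi 0 <= x' ->
  hitting_time T eta x = Finite t -> exists t', hitting_time T xi x' = Finite t' /\ t' <= t.
Proof.
  intros Hxi Heta He HT Hex Hx' Ht.
  destruct (Req_dec x' (xi 0)) as [->|Hne].
  { exists 0. split; [apply hitting_time_start|]. eapply hitting_time_nonneg; eassumption. }
  assert (Hx : eta 0 < x) by (specialize (He 0 ltac:(split; lra)); lra).
  apply hitting_time_finite_iff in Ht; [|exact Heta|lra]. destruct Ht as [HtT Hh].
  destruct (hits_compare_right (frozen_outside 0 T xi) (frozen_outside 0 T eta) x x' e t)
    as [t' [Ht' Hh']].
  - apply frozen_outside_continuous; [exact HT|exact Hxi].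
  - apply frozen_outside_continuous; [exact HT|exact Heta].
  - intros s Hs. rewrite !frozen_outside_eq by lra. apply He. split; lra.
  - exact Hex.
  - rewrite frozen_outside_eq; lra.
  - apply frozen_hits; assumption.
  - exists t'. split; [|exact Ht'].
    apply hitting_time_finite_iff; [exact Hxi|exact Hne|]. split; [lra|].
    apply (frozen_hits T); [lra|exact Hh'].
Qed.

Lemma hitting_time_compare_left (T : R) (xi eta : R -> R) (x x' e t : R) :
  driver T xi -> driver T eta -> (forall s, Icc 0 T s -> xi s - e <= eta s) ->
  0 <= T -> e < x' - x -> x' <= xi 0 ->
  hitting_time T eta x = Finite t -> exists t', hitting_time T xi x' = Finite t' /\ t' <= t.
Proof.
  intros Hxi Heta He HT Hex Hx' Ht.
  apply hitting_time_opp in Ht; [|exact Heta].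
  destruct (hitting_time_compare_right T (fun s => - xi s) (fun s => - eta s) (- x) (- x') e t)
    as [t' [H1 H2]]; try assumption.
  - apply driver_opp, Hxi.
  - apply driver_opp, Heta.
  - intros s Hs. specialize (He s Hs). lra.
  - lra.
  - lra.
  - exists t'. split; [|exact H2]. apply (hitting_time_opp T xi x' t' Hxi), H1.
Qed.

Lemma hitting_time_increasing_right (T : R) (xi : R -> R) (x x' t t' : R) :
  driver T xi -> 0 <= T -> xi 0 <= x' -> x' < x ->
  hitting_time T xi x' = Finite t' -> hitting_time T xi x = Finite t -> t' < t.
Proof.
  intros Hxi HT Hx' Hlt Ht' Ht. destruct (Req_dec x' (xi 0)) as [->|Hne].
  { rewrite hitting_time_start in Ht'. injection Ht' as <-.
    eapply hitting_time_pos; [exact Hxi| |exact Ht]. lra. }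
  apply hitting_time_finite_iff in Ht; [|exact Hxi|lra].
  apply hitting_time_finite_iff in Ht'; [|exact Hxi|lra].
  apply (hits_increasing_right (frozen_outside 0 T xi) x x').
  - apply frozen_outside_continuous; [exact HT|exact Hxi].
  - rewrite frozen_outside_eq; lra.
  - exact Hlt.
  - apply frozen_hits; tauto.
  - apply frozen_hits; tauto.
Qed.

(** * Comparison of weldings *)

Lemma welding_0 (T : R) (xi : R -> R) (a b : R) (phi : R -> R) :
  driver T xi -> xi 0 = 0 -> conformal_welding T xi a b phi -> phi 0 = 0.
Proof.
  intros Hxi H0 [Ha [Hb [_ [_ Hphi]]]].
  assert (H := Hphi 0 ltac:(split; lra)).
  rewrite <- H0 in H at 1. rewrite hitting_time_start in H.
  destruct (Req_dec (phi 0) 0) as [|Hne]; [assumption|exfalso].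
  symmetry in H. apply hitting_time_pos in H; [lra|exact Hxi|lra].
Qed.

(** The point [- a'], moved by [d] towards 0, is hit under [xi] because [- a']
    itself is hit under [eta]; so it lies in [[- a, b]], the set of points hit
    under [xi]. The same argument applies to [b']. *)
Lemma welding_domain_compare (T : R) (xi eta : R -> R) (a b a' b' e d : R) (phi psi : R -> R) :
  driver T xi -> driver T eta -> xi 0 = 0 -> eta 0 = 0 -> 0 <= T ->
  (forall s, Icc 0 T s -> Rabs (eta s - xi s) <= e) -> e < d ->
  conformal_welding T xi a b phi -> conformal_welding T eta a' b' psi ->
  a' <= a + d /\ b' <= b + d.
Proof.
  intros Hxi Heta Hx0 He0 HT He Hed [Ha [Hb [Hfin _]]] [Ha' [Hb' [Hfin' _]]].
  assert (He' : forall s, Icc 0 T s -> xi s - e <= eta s <= xi s + e).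
  { intros s Hs. specialize (He s Hs). apply Rabs_le_between in He. lra. }
  split.
  - apply Rnot_lt_le. intros Hlt.
    assert (Hf : is_finite (hitting_time T eta (- a'))) by (apply Hfin'; split; lra).
    destruct (hitting_time_compare_left T xi eta (- a') (- a' + d) e _ Hxi Heta
      (fun s Hs => proj1 (He' s Hs)) HT ltac:(lra) ltac:(lra) (eq_sym Hf)) as [t [Ht _]].
    assert (HI : Icc (- a) b (- a' + d)) by (apply Hfin; rewrite Ht; reflexivity).
    unfold Icc in HI. lra.
  - apply Rnot_lt_le. intros Hlt.
    assert (Hf : is_finite (hitting_time T eta b')) by (apply Hfin'; split; lra).
    destruct (hitting_time_compare_right T xi eta b' (b' - d) e _ Hxi Heta
      (fun s Hs => proj2 (He' s Hs)) HT ltac:(lra) ltac:(lra) (eq_sym Hf)) as [t [Ht _]].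
    assert (HI : Icc (- a) b (b' - d)) by (apply Hfin; rewrite Ht; reflexivity).
    unfold Icc in HI. lra.
Qed.

(** Suppose [psi x' - d > phi x]. Write [tau] and [tau'] for the hitting times
    under [xi] and [eta]. Then
    [tau (psi x' - d) <= tau' (psi x') = tau' x' <= tau x = tau (phi x)],
    where the inequalities are the comparisons on the right and on the left;
    this contradicts that [tau] increases to the right of 0. The two
    drivers may be exchanged, so one statement gives the bounds in both
    directions. The alternative [x' = 0] serves when
    shifting by [d] would leave the interval. *)
Lemma welding_compare (T : R) (xi eta : R -> R) (a b a' b' e d : R) (phi psi : R -> R) (x x' : R) :
  driver T xi -> driver T eta -> xi 0 = 0 -> eta 0 = 0 -> 0 <= T ->
  (forall s, Icc 0 T s -> Rabs (eta s - xi s) <= e) -> e < d ->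
  conformal_welding T xi a b phi -> conformal_welding T eta a' b' psi ->
  Icc (- a) 0 x -> Icc (- a') 0 x' -> x <= x' - d \/ x' = 0 ->
  psi x' <= phi x + d.
Proof.
  intros Hxi Heta Hx0 He0 HT He Hed Hphi Hpsi Hx Hx' Hxx'.
  assert (Hpsi0 := welding_0 T eta a' b' psi Heta He0 Hpsi).
  destruct Hphi as [Ha [Hb [Hfin [[_ [Hr _]] Hw]]]].
  destruct Hpsi as [Ha' [Hb' [Hfin' [[_ [Hr' _]] Hw']]]].
  specialize (Hr x Hx). specialize (Hr' x' Hx'). specialize (Hw x Hx). specialize (Hw' x' Hx').
  unfold Icc in *.
  assert (He' : forall s, 0 <= s <= T -> xi s - e <= eta s <= xi s + e).
  { intros s Hs. specialize (He s Hs). apply Rabs_le_between in He. lra. }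
  assert (Hee : 0 <= e).
  { specialize (He 0 ltac:(lra)). assert (H := Rabs_pos (eta 0 - xi 0)). lra. }
  destruct Hxx' as [Hxx'| ->]; [|lra].
  apply Rnot_lt_le. intros Hlt.
  assert (Hf : is_finite (hitting_time T xi x)) by (apply Hfin; lra).
  set (t := real (hitting_time T xi x)) in *.
  destruct (hitting_time_compare_left T eta xi x x' e t Heta Hxi)
    as [t1 [Ht1 Hle1]]; try lra; [|exact (eq_sym Hf)|].
  { intros s Hs. specialize (He' s Hs). lra. }
  rewrite Hw' in Ht1.
  destruct (hitting_time_compare_right T xi eta (psi x') (psi x' - d) e t1 Hxi Heta)
    as [t2 [Ht2 Hle2]]; try lra; [|exact Ht1|].
  { intros s Hs. specialize (He' s Hs). lra. }
  assert (Hphi : hitting_time T xi (phi x) = Finite t) by (rewrite <- Hw; exact (eq_sym Hf)).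
  assert (H := hitting_time_increasing_right T xi (psi x' - d) (phi x) t2 t Hxi HT
    ltac:(lra) ltac:(lra) Hphi Ht2).
  lra.
Qed.

Lemma uniform_continuity_Icc (f : R -> R) (a b eps : R) :
  a <= b -> continuous_on (U := R_UniformSpace) (Icc a b) f -> 0 < eps ->
  exists delta, 0 < delta /\ forall u v, Icc a b u -> Icc a b v ->
    Rabs (u - v) < delta -> Rabs (f u - f v) < eps.
Proof.
  intros Hab Hf He.
  destruct (@Heine_cor2 (frozen_outside a b f) a b
    (fun s _ => frozen_outside_continuous a b f Hab Hf s) (mkposreal _ He)) as [delta H].
  exists delta. split; [apply cond_pos|]. intros u v Hu Hv Huv.
  rewrite <- (frozen_outside_eq a b f u Hu), <- (frozen_outside_eq a b f v Hv).
  apply H; assumption.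
Qed.

Theorem theorem4p2 :
  forall (T : R) (xi : R -> R) (xi_ : nat -> R -> R)
    (a b : R) (phi : R -> R) (a_ b_ : nat -> R) (phi_ : nat -> R -> R),
    0 < T ->
    simple_curve_driver0 T xi ->
    (forall n : nat, simple_curve_driver0 T (xi_ n)) ->
    conformal_welding T xi a b phi ->
    (forall n : nat, conformal_welding T (xi_ n) (a_ n) (b_ n) (phi_ n)) ->
    uniform_cvg_on (Icc 0 T) xi_ xi ->
    is_lim_seq a_ (Finite a) /\
    is_lim_seq b_ (Finite b) /\
    (forall c : R, 0 <= c < a ->
       uniform_cvg_on (Icc (- c) 0) phi_ phi).
Proof.
  intros T xi xi_ a b phi a_ b_ phi_ HT [[Hxi _] Hx0] Hsc Hphi Hphi_ Hcv.
  assert (Hxi_ : forall n, driver T (xi_ n)) by (intros n; apply (Hsc n)).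
  assert (Hx0_ : forall n, xi_ n 0 = 0) by (intros n; apply (Hsc n)).
  assert (HT' : 0 <= T) by lra.
  assert (Hclose : forall d, 0 < d -> exists N, forall n, (N <= n)%nat ->
    forall s, Icc 0 T s -> Rabs (xi_ n s - xi s) <= d / 2).
  { intros d Hd. destruct (Hcv (d / 2) ltac:(lra)) as [N HN]. exists N.
    intros n Hn s Hs. left. apply HN; assumption. }
  assert (Hends : forall d, 0 < d -> exists N, forall n, (N <= n)%nat ->
    Rabs (a_ n - a) <= d /\ Rabs (b_ n - b) <= d).
  { intros d Hd. destruct (Hclose d Hd) as [N HN]. exists N. intros n Hn.
    assert (H1 := welding_domain_compare T xi (xi_ n) a b (a_ n) (b_ n) (d / 2) d phi (phi_ n)
      Hxi (Hxi_ n) Hx0 (Hx0_ n) HT' (HN n Hn) ltac:(lra) Hphi (Hphi_ n)).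
    assert (HN' : forall s, Icc 0 T s -> Rabs (xi s - xi_ n s) <= d / 2).
    { intros s Hs. rewrite Rabs_minus_sym. apply HN; assumption. }
    assert (H2 := welding_domain_compare T (xi_ n) xi (a_ n) (b_ n) a b (d / 2) d (phi_ n) phi
      (Hxi_ n) Hxi (Hx0_ n) Hx0 HT' HN' ltac:(lra) (Hphi_ n) Hphi).
    split; apply Rabs_le_between; lra. }
  split; [|split].
  - apply is_lim_seq_spec. intros eps. destruct (Hends (eps / 2)) as [N HN]; [apply is_pos_div_2|].
    exists N. intros n Hn. assert (H := cond_pos eps). destruct (HN n Hn). lra.
  - apply is_lim_seq_spec. intros eps. destruct (Hends (eps / 2)) as [N HN]; [apply is_pos_div_2|].
    exists N. intros n Hn. assert (H := cond_pos eps). destruct (HN n Hn). lra.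
  - intros c Hc eps He.
    destruct (uniform_continuity_Icc phi (- a) 0 (eps / 2)) as [delta [Hdelta Huc]];
      [lra|apply Hphi|lra|].
    (* [d] is the shift of the starting points: small for the modulus of
       continuity of [phi], small against [eps], and small enough for the
       shifted point [x - d] to remain in the domain of [phi] and [x] in
       that of [phi_ n]. *)
    set (d := Rmin (delta / 2) (Rmin (eps / 2) (a - c))).
    assert (Hd : 0 < d) by (repeat apply Rmin_glb_lt; lra).
    assert (Hd1 : d <= delta / 2) by apply Rmin_l.
    assert (Hd2 : d <= eps / 2) by (eapply Rle_trans; [apply Rmin_r|apply Rmin_l]).
    assert (Hd3 : d <= a - c) by (eapply Rle_trans; [apply Rmin_r|apply Rmin_r]).
    destruct (Hclose d Hd) as [N1 HN1]. destruct (Hends d Hd) as [N2 HN2].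
    exists (max N1 N2). intros n Hn x [Hx1 Hx2].
    assert (Hn1 := HN1 n ltac:(lia)). destruct (HN2 n ltac:(lia)) as [Han _].
    apply Rabs_le_between in Han.
    assert (Hn1' : forall s, Icc 0 T s -> Rabs (xi s - xi_ n s) <= d / 2).
    { intros s Hs. rewrite Rabs_minus_sym. apply Hn1, Hs. }
    assert (Hup : phi_ n x <= phi (x - d) + d).
    { apply (welding_compare T xi (xi_ n) a b (a_ n) (b_ n) (d / 2) d phi (phi_ n));
        try assumption; auto; try lra; split; lra. }
    (* The same comparison with the two drivers exchanged. *)
    assert (Hlo : phi (Rmin (x + d) 0) <= phi_ n x + d).
    { apply (welding_compare T (xi_ n) xi (a_ n) (b_ n) a b (d / 2) d (phi_ n) phi);
        try assumption; auto; try lra.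
      - split; lra.
      - split; [apply Rmin_glb; lra|apply Rmin_r].
      - unfold Rmin. destruct (Rle_dec (x + d) 0); lra. }
    assert (Hx : Icc (- a) 0 x) by (split; lra).
    assert (H1 := Huc (x - d) x ltac:(split; lra) Hx ltac:(apply Rabs_def1; lra)).
    assert (H2 := Huc (Rmin (x + d) 0) x).
    apply Rabs_def2 in H1.
    assert (Hmin : x <= Rmin (x + d) 0 <= x + d).
    { split; [apply Rmin_glb; lra|apply Rmin_l]. }
    assert (H3 := H2 ltac:(split; [lra|apply Rmin_r]) Hx ltac:(apply Rabs_def1; lra)).
    apply Rabs_def2 in H3. apply Rabs_def1; lra.
Qed.
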